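(* There exist anti-ferromagnetic parameters $(\beta,\gamma,\lambda)$ and an integer $d$ such that the two-state spin system with parameters $(\beta,\gamma,\lambda)$ has strong spatial mixing on the infinite $d$-regular tree but does not have strong spatial mixing on the family of all graphs of maximum degree at most $d$.
   Context: Two-state spin system with parameters $\beta,\gamma\ge0$, $\lambda>0$ on a finite graph $G=(V,E)$: configuration $\sigma:V\to\{0,1\}$ has weight $w(\sigma)=\prod_{(u,v)\in E}A_{\sigma(u),\sigma(v)}\prod_{v}b_{\sigma(v)}$ with $A_{0,0}=\beta$, $A_{0,1}=A_{1,0}=1$, $A_{1,1}=\gamma$, $b_0=\lambda$, $b_1=1$; Gibbs measure $\rho(\sigma)=w(\sigma)/\sum_{\sigma'}w(\sigma')$. Anti-ferromagnetic: $0\le\beta\le\gamma$, $\gamma>0$, $\beta\gamma<1$, $\lambda>0$. $p_v^{\sigma_\Lambda}$ is the Gibbs probability that $v$ has spin $0$ conditioned on the configuration on $\Lambda$ being $\sigma_\Lambda$. Strong spatial mixing on a family of finite graphs: there are constants $C,c>0$ such that for all $G$ in the family, $v\in V$, $\Lambda\subseteq V$, $\sigma_\Lambda,\tau_\Lambda\in\{0,1\}^\Lambda$, $|p_v^{\sigma_\Lambda}-p_v^{\tau_\Lambda}|\le C\exp(-c\,\mathrm{dist}_G(v,S))$, $S$ being the set where $\sigma_\Lambda,\tau_\Lambda$ differ. Strong spatial mixing on the infinite $d$-regular tree means strong spatial mixing (in this sense) on the family of finite balls (induced subtrees) of the infinite $d$-regular tree. *)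

(* Defs.v *)
From HB Require Import structures.
From mathcomp Require Import all_boot all_order all_algebra.
From mathcomp Require Import reals sequences exp.

Set Implicit Arguments.
Unset Strict Implicit.
Unset Printing Implicit Defensive.

Import Order.TTheory GRing.Theory Num.Theory.
Local Open Scope ring_scope.

Record sgraph := SGraph {
  vertex :> finType;
  adj : rel vertex;
  adj_sym : symmetric adj;
  adj_irr : irreflexive adj
}.

(* [None] stands for an infinite distance ([S] empty or unreachable from [v]).
   A shortest path has fewer than [#|G|] edges, so the bound on [n] is
   harmless. *)
Definition dist (G : sgraph) (v : G) (S : {set G}) : option nat :=
  ohead [seq n <- iota 0 #|G| |
    [exists p : n.-tuple G, path (@adj G) v p && (last v p \in S)]].

Section SpinSystem.
Variables (R : realType) (beta gamma lambda : R).

Definition antiferromagnetic : Prop :=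
  [/\ 0 <= beta, beta <= gamma, 0 < gamma, beta * gamma < 1 & 0 < lambda].

(* Spin 0 is [false] and spin 1 is [true]. *)
Definition interaction (i j : bool) : R :=
  match i, j with
  | false, false => beta
  | true, true => gamma
  | _, _ => 1
  end.

Definition local_field (i : bool) : R := if i then 1 else lambda.

Definition config (G : sgraph) := {ffun G -> bool}.

(* Each edge is counted once, oriented along the enumeration of the vertices;
   the orientation is irrelevant as [interaction] is symmetric. *)
Definition weight (G : sgraph) (s : config G) : R :=
  (\prod_(e : G * G | adj e.1 e.2 && (enum_rank e.1 < enum_rank e.2)%N)
     interaction (s e.1) (s e.2))
  * (\prod_(v : G) local_field (s v)).

Definition gibbs (G : sgraph) (s : config G) : R :=
  weight s / \sum_(t : config G) weight t.

Definition prob (G : sgraph) (E : pred (config G)) : R :=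
  \sum_(s | E s) gibbs s.

(* A configuration on [L] is represented by any extension of it to [G]. *)
Definition agree (G : sgraph) (L : {set G}) (s : config G) : pred (config G) :=
  fun t => [forall u in L, t u == s u].

Definition marginal0 (G : sgraph) (v : G) (L : {set G}) (s : config G) : R :=
  prob (fun t => agree L s t && (t v == false)) / prob (agree L s).

Definition discrepancy (G : sgraph) (L : {set G}) (s t : config G) : {set G} :=
  [set u in L | s u != t u].

(* [exp (- c * n)], with the convention [exp (- oo) = 0]. *)
Definition decay (c : R) (n : option nat) : R :=
  if n is Some k then expR (- c * k%:R) else 0.

(* The conditional probabilities are only defined for boundary conditions of
   positive probability; this is a restriction only when [beta = 0]. *)
Definition strong_spatial_mixing (F : sgraph -> Prop) : Prop :=
  exists C c : R, [/\ 0 < C, 0 < c &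
    forall G : sgraph, F G ->
    forall (v : G) (L : {set G}) (s t : config G),
      0 < prob (agree L s) -> 0 < prob (agree L t) ->
      `|marginal0 v L s - marginal0 v L t|
        <= C * decay c (dist v (discrepancy L s t))].

End SpinSystem.

Definition max_degree_le (d : nat) (G : sgraph) : Prop :=
  forall u : G, (#|[set v | adj u v]| <= d)%N.

(* The infinite d-regular tree (d >= 2) is the Cayley graph of the free product
   of d copies of Z/2: its vertices are the words over d letters without two
   equal consecutive letters, and the neighbours of a word are obtained by
   adding or deleting a first letter. The distance to the empty word is the
   length. *)
Definition reduced (d : nat) (w : seq 'I_d) : bool :=
  sorted (fun a b => a != b) w.

Definition tree_adj (d : nat) : rel (seq 'I_d) :=
  fun x y => [exists a, (y == a :: x) || (x == a :: y)].

Lemma tree_adj_sym d : symmetric (@tree_adj d).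
Proof. by move=> x y; apply: eq_existsb => a; rewrite orbC. Qed.

Lemma tree_adj_irr d : irreflexive (@tree_adj d).
Proof.
move=> x; apply/existsP => -[a]; rewrite orbb => /eqP/(congr1 size)/eqP.
by rewrite /= eqn_leq ltnn andbF.
Qed.

(* The tree is vertex-transitive (multiplication in the free product), so every
   ball of radius r is isomorphic to the one centred at the empty word. *)
Definition ball_vertex (d r : nat) : finType :=
  {w : r.-bseq 'I_d | reduced w}.

Definition ball_adj (d r : nat) : rel (ball_vertex d r) :=
  fun x y => tree_adj (val (val x)) (val (val y)).

Lemma ball_adj_sym d r : symmetric (@ball_adj d r).
Proof. by move=> x y; apply: tree_adj_sym. Qed.

Lemma ball_adj_irr d r : irreflexive (@ball_adj d r).
Proof. by move=> x; apply: tree_adj_irr. Qed.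

Definition tree_ball (d r : nat) : sgraph :=
  SGraph (@ball_adj_sym d r) (@ball_adj_irr d r).

Definition regular_tree_balls (d : nat) (G : sgraph) : Prop :=
  exists r : nat, G = tree_ball d r.

(* Main.v *)
Require Import Defs.
From mathcomp Require Import all_boot all_order all_algebra.
From mathcomp Require Import reals sequences exp.
From mathcomp Require Import ring lra.

(* With beta = 0 a vertex [v] may take spin 0 only if all its neighbours have
   spin 1, and then with conditional probability lambda / (lambda + gamma^deg v):
   high degree suppresses spin 0. Take lambda = 16 gamma^3 with gamma >= 64, d = 4.

   In a ball of the 4-regular tree every vertex has degree 4 or at most 1, so the
   total influence of its neighbours on a vertex is at most 64 / (16 + gamma) or
   16 gamma^2 / (16 gamma^2 + 1), both less than 1: this is Dobrushin's uniqueness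
   condition, and it yields strong spatial mixing.

   In the binary tree of depth n the inner vertices have degree 3. If Z0, Z1 are
   the partition functions with root spin 0, 1 and constant spin on the leaves,
   adding a level maps (Z0, Z1) to (lambda Z1^2, (Z0 + gamma Z1)^2), which exchanges
   the regions Z0 <= gamma Z1 and Z0 >= 4 gamma Z1. The two constant boundary
   conditions start in different regions, so their influence on the root never
   fades. *)

Set Implicit Arguments.
Unset Strict Implicit.
Unset Printing Implicit Defensive.

Import Order.TTheory GRing.Theory Num.Theory.
Local Open Scope ring_scope.

(** * Preliminaries: exponential decay and edge orientations *)

Lemma expR_decay_le0 (R : realType) (x C c : R) : 0 < C -> 0 < c ->
  (forall n : nat, x <= C * expR (- c * n%:R)) -> x <= 0.
Proof.
move=> C0 c0 H; rewrite leNgt; apply/negP => x0.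
(* By the Archimedean property some [n] has [C < x * c * n], which contradicts
   [expR (c * n) >= 1 + c * n]. *)
have [n Hn] : exists n : nat, C / (x * c) < n%:R.
  exists (Num.bound (C / (x * c))); apply: archi_boundP.
  by rewrite divr_ge0 // ltW // mulr_gt0.
move: Hn; rewrite ltr_pdivrMr ?mulr_gt0 // => Hn.
have := H n; rewrite mulNr expRN ler_pdivlMr ?expR_gt0 // => Hx.
have : x * (1 + c * n%:R) <= C.
  by apply: le_trans Hx; rewrite ler_pM2l // expR_ge1Dx.
nra.
Qed.

(** Edges on which the two orientations agree give the same factors; the others are matched by
    swapping endpoints, which leaves [F] unchanged. *)
Lemma edge_prod_orientation (R : comNzRingType) (G : sgraph) (F : G -> G -> R)
    (o1 o2 : rel G) :
  (forall x y, F x y = F y x) ->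
  (forall x y, adj x y -> o1 y x = ~~ o1 x y) ->
  (forall x y, adj x y -> o2 y x = ~~ o2 x y) ->
  \prod_(e : G * G | adj e.1 e.2 && o1 e.1 e.2) F e.1 e.2 =
  \prod_(e : G * G | adj e.1 e.2 && o2 e.1 e.2) F e.1 e.2.
Proof.
move=> Fsym O1 O2.
rewrite (bigID (fun e : G * G => o2 e.1 e.2)) /=.
rewrite [RHS](bigID (fun e : G * G => o1 e.1 e.2)) /=; congr (_ * _).
  by apply: eq_bigl => e; rewrite andbAC.
pose sw (e : G * G) := (e.2, e.1).
have swK : involutive sw by case.
rewrite (reindex_inj (inv_inj swK)) /=; apply: eq_big => [[x y]|[x y] _] /=.
  rewrite adj_sym; case xy: (adj x y) => //=.
  by rewrite O1 // O2 // negbK andbC.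
exact: Fsym.
Qed.

Lemma enum_rank_orientation (G : sgraph) (u v : G) : adj u v ->
  (enum_rank v < enum_rank u)%N = ~~ (enum_rank u < enum_rank v)%N.
Proof.
move=> uv; rewrite -leqNgt ltn_neqAle.
case: eqP => //= /val_inj /enum_rank_inj vu.
by move: uv; rewrite vu adj_irr.
Qed.

(** * Single-site updates of configurations *)

Definition upd (G : sgraph) (x : config G) (v : G) (b : bool) : config G :=
  [ffun u => if u == v then b else x u].

Section Updates.
Variable G : sgraph.
Implicit Types (x : config G) (u v : G).

Lemma updE x v b u : upd x v b u = if u == v then b else x u.
Proof. by rewrite ffunE. Qed.

Lemma upd_id x v : upd x v (x v) = x.
Proof. by apply/ffunP => u; rewrite updE; case: eqP => // ->. Qed.

Lemma upd_upd x v b b' : upd (upd x v b) v b' = upd x v b'.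
Proof. by apply/ffunP => u; rewrite !updE; case: eqP. Qed.

Lemma upd_comm x u v b b' : u != v ->
  upd (upd x u b) v b' = upd (upd x v b') u b.
Proof.
move=> uv; apply/ffunP => w; rewrite !updE.
by case: (w =P v) => // ->; rewrite eq_sym (negbTE uv).
Qed.

Lemma agree_upd (L : {set G}) (s : config G) x v b :
  v \notin L -> agree L s (upd x v b) = agree L s x.
Proof.
move=> vL; apply: eq_forallb => u; rewrite updE.
by case: (u =P v) => // ->; rewrite (negbTE vL).
Qed.

(** Setting the spin at [v] to 1 is a bijection from the configurations with spin 0 at [v] onto
    those with spin 1, so the sum can be taken over pairs that differ only at [v]. *)
Lemma sum_config_split (R : zmodType) (P : pred (config G)) (F : config G -> R) v :
  (forall x b, P (upd x v b) = P x) ->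
  \sum_(x | P x) F x =
  \sum_(x | P x && (x v == false)) (F (upd x v false) + F (upd x v true)).
Proof.
move=> HP; rewrite (bigID (fun x : config G => x v == false)) big_split /=.
congr (_ + _).
  by apply: eq_bigr => x /andP[_ /eqP xv]; rewrite -xv upd_id.
rewrite (reindex_onto (fun x => upd x v true) (fun x => upd x v false)) /=.
  apply: eq_bigl => x; rewrite HP updE eqxx upd_upd andbT; congr (_ && _).
  apply/eqP/eqP => [<-|xv]; first by rewrite updE eqxx.
  by rewrite -xv upd_id.
move=> x /andP[_ xv]; rewrite upd_upd; have {1}-> : true = x v by case: (x v) xv.
exact: upd_id.
Qed.

End Updates.

(** * Local structure of the Gibbs weight and conditional expectations *)

Section Weights.
Variables (R : realType) (beta gamma lambda : R).
Hypotheses (beta0 : 0 <= beta) (gamma0 : 0 < gamma) (lambda0 : 0 < lambda).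
Variable G : sgraph.
Implicit Types (x s t : config G) (u v : G) (L : {set G}).

Local Notation A := (interaction beta gamma).
Local Notation b := (local_field lambda).
Local Notation w := (weight beta gamma lambda).

Lemma interaction_sym i j : A i j = A j i.
Proof. by case: i j => [] []. Qed.

Lemma interaction_ge0 i j : 0 <= A i j.
Proof. by case: i j => [] [] //=; exact: ltW. Qed.

(** Allows the orientation to be adapted to the situation: away from a chosen vertex here, away from
    the root of a joined tree later. *)
Lemma weight_orientation x (o : rel G) :
  (forall u v, adj u v -> o v u = ~~ o u v) ->
  w x = (\prod_(e : G * G | adj e.1 e.2 && o e.1 e.2) A (x e.1) (x e.2))
        * \prod_(v : G) b (x v).
Proof.
move=> Ho; congr (_ * _).
apply: (@edge_prod_orientation _ _ (fun u v => A (x u) (x v))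
  (fun u v => enum_rank u < enum_rank v)%N) => // u v.
  by rewrite interaction_sym.
exact: enum_rank_orientation.
Qed.

Lemma weight_ge0 x : 0 <= w x.
Proof.
apply: mulr_ge0; apply: prodr_ge0 => *; first exact: interaction_ge0.
by rewrite /local_field; case: ifP => // _; exact: ltW.
Qed.

Definition spin_weight (v : G) x (i : bool) : R :=
  b i * \prod_(u | adj v u) A i (x u).

(** Only the factors meeting [v] depend on its spin. The common factor [C] stays abstract because it
    cancels in conditional probabilities. *)
Lemma weight_upd v x :
  exists C : R, forall i, w (upd x v i) = C * spin_weight v x i.
Proof.
(* All edges at [v] are oriented out of [v], so they are exactly the pairs with first component
   [v]. *)
pose o := [rel u u' : G | (u == v) || (u' != v) && (enum_rank u < enum_rank u')%N].
have Ho u u' : adj u u' -> o u' u = ~~ o u u'.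
  move=> uu'; rewrite /=.
  have nuu' : u != u' by apply: contraTneq uu' => ->; rewrite adj_irr.
  case: (u =P v) => [uv|_] /=; first by rewrite orbF -uv eq_sym; apply/negbTE.
  by case: (u' =P v) => //= _; exact: enum_rank_orientation.
pose edges (P : pred (G * G)) (y : config G) :=
  \prod_(e : G * G | (adj e.1 e.2 && o e.1 e.2) && P e) A (y e.1) (y e.2).
exists (edges (fun e => e.1 != v) x * \prod_(u | u != v) b (x u)) => i.
rewrite (weight_orientation _ Ho) (bigID (fun e : G * G => e.1 == v)) /=.
rewrite [\prod_u _](bigD1 v) //= updE eqxx.
have -> : \prod_(u | u != v) b (upd x v i u) = \prod_(u | u != v) b (x u).
  by apply: eq_bigr => u /negbTE uv; rewrite updE uv.
rewrite -/(edges (fun e => e.1 == v) (upd x v i)).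
rewrite -/(edges (fun e => e.1 != v) (upd x v i)).
have -> : edges (fun e => e.1 != v) (upd x v i) = edges (fun e => e.1 != v) x.
  apply: eq_bigr => -[u u'] /= /andP[/andP[_]].
  rewrite orbC => /orP[/andP[u'v _]|->//] uv.
  by rewrite !updE (negbTE uv) (negbTE u'v).
have -> : edges (fun e => e.1 == v) (upd x v i) = \prod_(u | adj v u) A i (x u).
  rewrite /edges (eq_bigl (fun e : G * G => (e.1 == v) && adj v e.2)); last first.
    move=> [u u'] /=; case: (u =P v) => [->|]; last by rewrite andbF.
    by rewrite !andbT.
  rewrite -(pair_big (pred1 v) (adj v) (fun u u' => A (upd x v i u) (upd x v i u'))) /=.
  rewrite big_pred1_eq; apply: eq_bigr => u vu; rewrite !updE eqxx.
  by case: eqP vu => // ->; rewrite adj_irr.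
by rewrite /spin_weight; ring.
Qed.

Definition mass L s (f : config G -> R) : R :=
  \sum_(x | agree L s x) w x * f x.

Definition cond_exp L s f := mass L s f / mass L s (fun=> 1).

Lemma prob_agree_gt0 L s :
  0 < prob beta gamma lambda (agree L s) -> 0 < mass L s (fun=> 1).
Proof.
rewrite /prob /gibbs -mulr_suml /mass => H.
under eq_bigr do rewrite mulr1.
rewrite lt_neqAle sumr_ge0 ?andbT => [|x _]; last exact: weight_ge0.
by apply: contraTneq H => <-; rewrite mul0r ltxx.
Qed.

Lemma marginal0E L s v : 0 < prob beta gamma lambda (agree L s) ->
  marginal0 beta gamma lambda v L s = cond_exp L s (fun x => (x v == false)%:R).
Proof.
(* If the partition function vanished, every probability would be 0, as the inverse of 0 is 0. *)
move=> H; have Z0 : \sum_(t : config G) w t != 0.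
  by apply: contraTneq H => Z0; rewrite /prob /gibbs -mulr_suml Z0 invr0 mulr0 ltxx.
rewrite /marginal0 /prob /gibbs -!mulr_suml /cond_exp /mass.
rewrite -mulf_div divff ?invr_eq0 // mulr1; congr (_ / _).
  rewrite big_mkcondr; apply: eq_bigr => x _.
  by case: eqP => _; rewrite ?mulr1 ?mulr0.
by apply: eq_bigr => x _; rewrite mulr1.
Qed.


(** * Heat-bath resampling of a single vertex *)

Definition heat_prob v x : R :=
  spin_weight v x false / (spin_weight v x false + spin_weight v x true).

(** [heat_prob v x] is the conditional probability of spin 0 at [v] given the other spins of [x];
    this is the expectation of [f] after resampling [v] accordingly. *)
Definition heat_bath v (f : config G -> R) x : R :=
  heat_prob v x * f (upd x v false) + (1 - heat_prob v x) * f (upd x v true).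

Lemma spin_weight_upd v u x i j :
  ~~ adj v u -> spin_weight v (upd x u j) i = spin_weight v x i.
Proof.
move=> vu; congr (_ * _); apply: eq_bigr => u' vu'; rewrite updE.
by case: eqP vu' => // ->; rewrite (negbTE vu).
Qed.

Lemma heat_prob_upd v u x j :
  ~~ adj v u -> heat_prob v (upd x u j) = heat_prob v x.
Proof. by move=> vu; rewrite /heat_prob !spin_weight_upd. Qed.

Lemma spin_weight0_ge0 v x : 0 <= spin_weight v x false.
Proof.
by apply: mulr_ge0; [exact: ltW|apply: prodr_ge0 => u _; exact: interaction_ge0].
Qed.

Lemma spin_weight1_gt0 v x : 0 < spin_weight v x true.
Proof. by rewrite /spin_weight mul1r; apply: prodr_gt0 => u _ /=; case: (x u). Qed.

Lemma spin_weight_sum_gt0 v x : 0 < spin_weight v x false + spin_weight v x true.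
Proof. by apply: ltr_wpDl; [exact: spin_weight0_ge0|exact: spin_weight1_gt0]. Qed.

Lemma heat_prob_ge0 v x : 0 <= heat_prob v x.
Proof. by apply: divr_ge0; [exact: spin_weight0_ge0|exact/ltW/spin_weight_sum_gt0]. Qed.

Lemma heat_prob_le1 v x : heat_prob v x <= 1.
Proof.
rewrite ler_pdivrMr ?spin_weight_sum_gt0 // mul1r lerDl.
exact/ltW/spin_weight1_gt0.
Qed.

(** The Gibbs measure is invariant under resampling a free vertex: the two configurations that
    differ at [v] have weights in the ratio of their [spin_weight]s. *)
Lemma mass_heat_bath L s v f :
  v \notin L -> mass L s (heat_bath v f) = mass L s f.
Proof.
move=> vL; have HP x i : agree L s (upd x v i) = agree L s x by exact: agree_upd.
rewrite /mass !(sum_config_split _ HP); apply: eq_bigr => x _.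
have [C HC] := weight_upd v x.
rewrite /heat_bath !heat_prob_upd ?adj_irr // !upd_upd !HC /heat_prob.
have := spin_weight_sum_gt0 v x; move: (spin_weight v x) => S /lt0r_neq0 S0.
by field.
Qed.

Lemma cond_exp_dist L s f c M : 0 < mass L s (fun=> 1) ->
  (forall x, agree L s x -> `|f x - c| <= M) -> `|cond_exp L s f - c| <= M.
Proof.
move=> m0 H.
have -> : cond_exp L s f - c = mass L s (fun x => f x - c) / mass L s (fun=> 1).
  rewrite /cond_exp -[X in _ - X](mulfK (lt0r_neq0 m0)) -mulrBl; congr (_ / _).
  rewrite /mass mulr_sumr -sumrB; apply: eq_bigr => x _.
  by rewrite mulr1 [c * _]mulrC mulrBr.
rewrite normrM normfV (gtr0_norm m0) ler_pdivrMr // /mass mulr_sumr.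
apply: le_trans (ler_norm_sum _ _ _) _; apply: ler_sum => x Hx.
rewrite normrM (ger0_norm (weight_ge0 x)) mulr1 mulrC.
by apply: ler_wpM2r; [exact: weight_ge0|exact: H].
Qed.

(** * Oscillations and Dobrushin's comparison of two boundary conditions *)

Definition osc_le (f : config G -> R) (D : G -> R) :=
  forall x u, `|f (upd x u false) - f (upd x u true)| <= D u.

Lemma osc_ge0 f D u : osc_le f D -> 0 <= D u.
Proof. by move=> fD; apply: le_trans (normr_ge0 _) (fD [ffun=> false] u). Qed.

Lemma osc_upd f D x u i j : osc_le f D -> `|f (upd x u i) - f (upd x u j)| <= D u.
Proof.
move=> fD; have D0 := osc_ge0 u fD.
by case: i; case: j; rewrite ?subrr ?normr0 // distrC.
Qed.

(** Telescoping: [x] is turned into [y] one vertex at a time, at cost [D u] for each vertex [u]. *)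
Lemma osc_total f D x y : osc_le f D -> `|f x - f y| <= \sum_u D u.
Proof.
move=> fD; suff H (l : seq G) (z : config G) : (forall u, u \notin l -> z u = y u) ->
    `|f z - f y| <= \sum_(u <- l) D u by apply: H => u; rewrite mem_index_enum.
elim: l z => [|u l IH] z zy.
  have -> : z = y by apply/ffunP => u; exact: zy.
  by rewrite subrr normr0 big_nil.
rewrite big_cons.
have -> : f z - f y = (f z - f (upd z u (y u))) + (f (upd z u (y u)) - f y) by ring.
apply: le_trans (ler_normD _ _) _; apply: lerD.
  by rewrite -{1}(upd_id z u); exact: osc_upd.
apply: IH => u' u'l; rewrite updE; case: eqP => [->//|/eqP u'u].
by apply: zy; rewrite inE negb_or u'u.
Qed.

Section Comparison.
Variables (L : {set G}) (s t : config G).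
Hypotheses (ms : 0 < mass L s (fun=> 1)) (mt : 0 < mass L t (fun=> 1)).
Variables (kappa : G -> R) (alpha : R).
Hypotheses (alpha0 : 0 <= alpha).
Hypothesis kappaP : forall v x, heat_prob v x <= kappa v.
Hypothesis kappa_deg : forall v, kappa v * #|[set u | adj v u]|%:R <= alpha.

(* [a u] bounds how much the two conditional measures can differ at [u], as in
   Dobrushin's comparison theorem. *)
Definition estimate (a : G -> R) := forall f D, osc_le f D ->
  `|cond_exp L s f - cond_exp L t f| <= \sum_u a u * D u.

Lemma estimate1 : estimate (fun=> 1).
Proof.
move=> f D fD; under eq_bigr do rewrite mul1r.
apply: (cond_exp_dist ms) => x _; rewrite distrC.
by apply: (cond_exp_dist mt) => y _; exact: osc_total.
Qed.

Lemma estimate_le a a' : (forall u, a u <= a' u) -> estimate a -> estimate a'.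
Proof.
move=> aa' ea f D fD; apply: le_trans (ea _ _ fD) _; apply: ler_sum => u _.
by apply: ler_wpM2r; [exact: osc_ge0 fD|].
Qed.

(** Resampling [v] removes the dependence on [v] and passes part of it to the neighbours. The factor
    is at most [kappa v], since the resampling probability stays in the interval from 0 to
    [kappa v]. *)
Lemma heat_bath_osc f D v : osc_le f D ->
  osc_le (heat_bath v f)
    (fun u => if u == v then 0 else D u + (if adj v u then kappa v * D v else 0)).
Proof.
move=> fD x u; case: eqP => [->|/eqP uv].
  by rewrite /heat_bath !heat_prob_upd ?adj_irr // !upd_upd subrr normr0.
rewrite /heat_bath !(@upd_comm _ _ u v) //.
set p := heat_prob v _; set q := heat_prob v _.
have p0 : 0 <= p by exact: heat_prob_ge0.
have p1 : 0 <= 1 - p by rewrite subr_ge0; exact: heat_prob_le1.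
pose g i j := f (upd (upd x v i) u j); rewrite -!/(g _ _).
(* Separates the change of [f] at [u] under a fixed resampling law from the change of the law
   itself. *)
rewrite [X in `|X|](_ : _ = (p * (g false false - g false true)
  + (1 - p) * (g true false - g true true))
  + (p - q) * (g false true - g true true)); last by ring.
apply: le_trans (ler_normD _ _) _; apply: lerD.
  have -> : D u = p * D u + (1 - p) * D u by ring.
  apply: le_trans (ler_normD _ _) _.
  by rewrite normrM (ger0_norm p0) normrM (ger0_norm p1) lerD // ler_wpM2l // fD.
rewrite normrM; case: ifP => [vu|/negbT vu]; last first.
  by rewrite /p /q !heat_prob_upd // subrr normr0 mul0r.
apply: ler_pM => //; last by rewrite /g -!(@upd_comm _ _ u v).
have := heat_prob_ge0 v (upd x u true); have := kappaP v (upd x u true).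
have := kappaP v (upd x u false); rewrite -/p -/q ler_norml => *; lra.
Qed.

(** Both expectations of [f] equal those of [heat_bath v f]. Applying the old estimate to the latter
    and collecting the terms in [D v] gives the new coefficient at [v]. *)
Lemma estimate_heat_bath a v : v \notin L -> estimate a ->
  estimate (fun u => if u == v then kappa v * \sum_(u' | adj v u') a u' else a u).
Proof.
move=> vL ea f D fD.
rewrite /cond_exp -!(mass_heat_bath _ f vL) -!/(cond_exp _ _ _).
apply: le_trans (ea _ _ (heat_bath_osc v fD)) _.
rewrite (bigD1 v) //= eqxx mulr0 add0r [leRHS](bigD1 v) //= eqxx.
rewrite (eq_bigr (fun u =>
  a u * D u + (if adj v u then a u * (kappa v * D v) else 0))); last first.
  by move=> u /negbTE ->; rewrite mulrDr; case: ifP; rewrite ?mulr0.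
rewrite big_split /= addrC; apply: lerD; last first.
  by apply: ler_sum => u /negbTE ->.
rewrite -big_mkcondr /= (eq_bigl (adj v)); last first.
  by move=> u; case: eqP => //= ->; rewrite adj_irr.
by rewrite -mulr_suml mulrCA mulrA.
Qed.

(** Both measures fix the same spin at [v], so [f] may be replaced by a function that ignores
    [v]. *)
Lemma estimate_pinned a v : v \in L -> s v = t v -> estimate a ->
  estimate (fun u => if u == v then 0 else a u).
Proof.
move=> vL svt ea f D fD.
have pinned (r : config G) : r v = s v ->
    cond_exp L r f = cond_exp L r (fun x => f (upd x v (s v))).
  move=> rs; congr (_ / _); apply: eq_bigr => x /forall_inP/(_ v vL)/eqP xr.
  by rewrite -rs -xr upd_id.
rewrite (pinned s) // (pinned t) //.
apply: le_trans (ea _ (fun u => if u == v then 0 else D u) _) _.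
  move=> x u; case: eqP => [->|/eqP uv]; first by rewrite !upd_upd subrr normr0.
  by rewrite !(@upd_comm _ _ u v).
by apply: ler_sum => u _; case: ifP => _; rewrite ?mul0r ?mulr0.
Qed.

Hypothesis alpha1 : alpha <= 1.
(** [h] stands for the distance to the discrepancy, possibly truncated, so that it is finite even
    when the discrepancy cannot be reached. *)
Variable h : G -> nat.
Hypothesis h_lip : forall u v, adj u v -> (h u <= (h v).+1)%N.
Hypothesis h_disc : forall u, u \in discrepancy L s t -> h u = 0%N.

Lemma kappa_ge0 v : 0 <= kappa v.
Proof. exact: le_trans (heat_prob_ge0 v [ffun=> false]) (kappaP _ _). Qed.

(* Starting from the trivial estimate 1, each sweep of single-site updates over all
   vertices gains a factor [alpha] wherever the discrepancy is still further away
   than the number of sweeps. *)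
Lemma estimate_power k : estimate (fun u => alpha ^+ minn k (h u)).
Proof.
elim: k => [|k IH].
  by apply: estimate_le estimate1 => u; rewrite min0n expr0.
(* The sweep goes vertex by vertex; [l] lists the vertices already improved. *)
suff H (l : seq G) : estimate (fun u => if u \in l then alpha ^+ minn k.+1 (h u)
                              else alpha ^+ minn k (h u)).
  by apply: estimate_le (H (enum G)) => u; rewrite mem_enum.
elim: l => [//|v l IHl].
have pow_le u : alpha ^+ minn k.+1 (h u) <= alpha ^+ minn k (h u).
  by apply: ler_wiXn2l => //; rewrite leq_min (leq_trans (geq_minl _ _)) // geq_minr.
have [hv0|hv] := posnP (h v).
  apply: estimate_le IHl => u; rewrite inE.
  by case: (u =P v) => [->|//]; rewrite hv0 !minn0; case: ifP.
have [vL|vL] := boolP (v \in L).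
  have svt : s v = t v.
    apply/eqP; apply: contraTT hv => svt; rewrite -leqNgt h_disc //.
    by rewrite inE vL.
  apply: estimate_le (estimate_pinned vL svt IHl) => u; rewrite inE.
  by case: (u =P v) => //= _; exact: exprn_ge0.
apply: estimate_le (estimate_heat_bath vL IHl) => u; rewrite inE.
case: (u =P v) => //= -> {u}.
(* Every neighbour [u] of [v] has [h u >= (h v).-1], so its coefficient is at most
   [alpha ^+ minn k (h v).-1]. Summing over the neighbours and multiplying by [kappa v] costs at
   most [alpha], the missing factor. *)
have -> : minn k.+1 (h v) = (minn k (h v).-1).+1 by rewrite -{1}(prednK hv) minnSS.
apply: le_trans
  (_ : kappa v * \sum_(u in [set u | adj v u]) alpha ^+ minn k (h v).-1 <= _).
  apply: ler_wpM2l; first exact: kappa_ge0.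
  rewrite [leRHS](eq_bigl (adj v)) => [|u]; last by rewrite inE.
  apply: ler_sum => u vu.
  apply: le_trans (_ : alpha ^+ minn k (h u) <= _); first by case: ifP.
  apply: ler_wiXn2l => //; rewrite leq_min geq_minl /=.
  by apply: leq_trans (geq_minr _ _) _; rewrite -ltnS prednK // h_lip.
rewrite sumr_const -mulr_natr mulrCA mulrA exprSr.
by rewrite -mulrA ler_wpM2l // exprn_ge0.
Qed.

(** After [h v] sweeps the estimate is applied to the indicator of spin 0 at [v], whose only
    oscillation is at [v]. *)
Lemma marginal_diff_le v :
  `|cond_exp L s (fun x => (x v == false)%:R)
    - cond_exp L t (fun x => (x v == false)%:R)|
    <= alpha ^+ h v.
Proof.
have := @estimate_power (h v) _ (fun u => (u == v)%:R); rewrite (bigD1 v) //= big1.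
  rewrite eqxx mulr1 addr0 minnn; apply => x u; rewrite !updE [u == v]eq_sym.
  by case: (v =P u) => _; rewrite /= ?subrr ?subr0 ?normr0 ?normr1.
by move=> u /negbTE ->; rewrite mulr0.
Qed.

End Comparison.
End Weights.

(** * From Dobrushin's condition to strong spatial mixing *)

Lemma ohead_filter_iota (P : pred nat) j N k :
  ohead [seq n <- iota j N | P n] = Some k ->
  forall m, (j <= m < k)%N -> ~~ P m.
Proof.
elim: N j => [//|N IH] j /=; case: ifP => [_ [<-]|Pj H] m /andP[jm mk].
  by move: (leq_ltn_trans jm mk); rewrite ltnn.
move: jm; rewrite leq_eqVlt => /orP[/eqP <-|jm]; first by rewrite Pj.
by apply: (IH _ H); rewrite jm.
Qed.

Section DobrushinMixing.
Variables (R : realType) (beta gamma lambda : R).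
Hypotheses (beta0 : 0 <= beta) (gamma0 : 0 < gamma) (lambda0 : 0 < lambda).

(** A neighbour can move the heat-bath probability at [v] by at most [kappa v], so the second clause
    bounds the total influence on [v]; Dobrushin's condition is the case [alpha < 1]. *)
Definition dobrushin (alpha : R) (G : sgraph) (kappa : G -> R) : Prop :=
  (forall v x, heat_prob beta gamma lambda v x <= kappa v) /\
  (forall v, kappa v * #|[set u | adj v u]|%:R <= alpha).

Lemma dobrushin_ssm (F : sgraph -> Prop) (c : R) : 0 < c ->
  (forall G, F G -> exists kappa : G -> R, dobrushin (expR (- c)) kappa) ->
  strong_spatial_mixing beta gamma lambda F.
Proof.
move=> c0 HF; exists 1, c; split=> // G FG v L s t ps pt; rewrite mul1r.
have [kappa [kappaP kappa_deg]] := HF G FG.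
rewrite !marginal0E //; set diff := `|_|.
pose S := discrepancy L s t.
pose reach n (u : G) := [exists p : n.-tuple G, path (@adj G) u p && (last u p \in S)].
have reachS n u u' : adj u u' -> reach n u' -> reach n.+1 u.
  move=> uu' /existsP[p /andP[pp lp]]; apply/existsP; exists [tuple of u' :: p].
  by rewrite /= uu' pp.
have bound n : (forall m, (m < n)%N -> ~~ reach m v) -> diff <= expR (- c * n%:R).
  (* [h u] is the least length of a walk from [u] to the discrepancy, truncated at [n]: [find]
     returns [n] when no shorter length works. *)
  move=> far; pose h u := find (reach^~ u) (iota 0 n).
  have hn u : (h u <= n)%N.
    by have := find_size (reach^~ u) (iota 0 n); rewrite size_iota.
  have hv : h v = n.
    apply/eqP; rewrite eqn_leq hn leqNgt -[X in (_ < X)%N](size_iota 0) -has_find.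
    by apply/hasPn => m; rewrite mem_iota => /far.
  rewrite expRM_natr -{1}hv /diff.
  apply: (@marginal_diff_le _ _ _ _ beta0 gamma0 lambda0 _ _ _ _ _ _ kappa) => //.
  - exact: prob_agree_gt0.
  - exact: prob_agree_gt0.
  - exact: expR_ge0.
  - by rewrite -expR0 ler_expR oppr_le0 ltW.
  - move=> u u' uu'; have [hu'|] := ltnP (h u') n; last first.
      by move=> nh; apply: leq_trans (hn _) (leqW nh).
    have ru' : reach (h u') u'.
      have := @nth_find _ 0%N (reach^~ u') (iota 0 n).
      by rewrite has_find size_iota nth_iota //; apply.
    rewrite leqNgt; apply/negP => lt_hu.
    have := before_find 0%N lt_hu.
    rewrite nth_iota ?add0n; last exact: leq_trans lt_hu (hn u).
    by rewrite (reachS _ _ _ uu').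
  - move=> u uS; rewrite /h; case: (n) => //= n'; rewrite ifT //.
    by apply/existsP; exists [tuple]; rewrite /= uS.
rewrite /decay; case E: (dist v (discrepancy L s t)) => [k|].
  by apply: bound => m mk; apply: (ohead_filter_iota E).
(* At infinite distance there is no walk of any length: a walk could be shortened to one with
   distinct vertices, of length less than [#|G|], which [dist] would have found. The bound then
   holds for every [n] and forces the difference to 0. *)
have far m : ~~ reach m v.
  apply/negP => /existsP[p /andP[pp]]; case/shortenP: pp => q pq uq _ lq.
  have sq : (size q < #|G|)%N.
    by have := max_card (mem (v :: q)); rewrite (card_uniqP uq).
  suff : size q \in [seq n <- iota 0 #|G| | reach n v].
    by move: E; rewrite /dist -/S; case: [seq _ <- _ | _].
  rewrite mem_filter mem_iota leq0n add0n sq !andbT.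
  by apply/existsP; exists (in_tuple q); rewrite pq.
apply: (@expR_decay_le0 _ _ 1 c) => // n; rewrite mul1r.
by apply: bound => m _; exact: far.
Qed.

End DobrushinMixing.

(** * Influence bound for [beta = 0] *)

(** A neighbour with spin 0 makes the probability vanish; if all neighbours have spin 1, equality
    holds. *)
Lemma heat_prob_hardcore (R : realType) (gamma lambda : R) (G : sgraph)
    (v : G) (x : config G) : 0 < gamma -> 0 < lambda ->
  heat_prob 0 gamma lambda v x <= lambda / (lambda + gamma ^+ #|[set u | adj v u]|).
Proof.
move=> g0 l0; rewrite /heat_prob /spin_weight /=.
have [/existsP[u /andP[vu xu]]|] := boolP [exists u, adj v u && (x u == false)].
  rewrite (bigD1 u) //= (eqP xu) !(mul0r, mulr0).
  by apply: divr_ge0; [|apply: addr_ge0; [|exact: exprn_ge0 (ltW _)]]; exact: ltW.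
rewrite negb_exists => /forallP Hx.
have xT u : adj v u -> x u = true.
  by move=> vu; have := Hx u; rewrite vu /= eqbF_neg negbK.
rewrite big1 => [|u vu]; last by rewrite xT.
rewrite (eq_bigr (fun=> gamma)) => [|u vu]; last by rewrite xT.
by rewrite prodr_const mulr1 mul1r cardsE.
Qed.

(** * Degrees in balls of the regular tree *)

Section BallDegree.
Variables (d r : nat).
Implicit Types x y : tree_ball d r.

Definition word x : seq 'I_d := val (val x).

(** Left multiplication by a generator in the free product of copies of Z/2, on reduced words. *)
Definition letter_mul (a : 'I_d) (w : seq 'I_d) : seq 'I_d :=
  if w is b :: w' then if a == b then w' else a :: w else [:: a].

Lemma letter_mul_reduced a w : reduced w -> reduced (letter_mul a w).
Proof.
case: w => [//|b w] /=; case: eqP => [_|/eqP ab] /=; last by rewrite /reduced /= ab.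
exact: path_sorted.
Qed.

Lemma letter_mul_size a w : (size (letter_mul a w) <= (size w).+1)%N.
Proof. by case: w => [//|b w] /=; case: eqP => //= _; rewrite ltnW // ltnW. Qed.

Lemma letter_mul_inj w : injective (letter_mul^~ w).
Proof.
case: w => [|b w] a a' /=; first by case.
case: eqP => [->|_]; case: eqP => [->|_] //.
- by move/(congr1 size)/eqP; rewrite /= eqn_leq [X in _ && X]ltnNge leqnSn andbF.
- by move/(congr1 size)/eqP; rewrite /= eqn_leq ltnNge leqnSn.
- by case.
Qed.

Lemma word_inj : injective word.
Proof. by move=> x y /val_inj/val_inj. Qed.

Lemma exists_word w : reduced w -> (size w <= r)%N -> exists x, word x = w.
Proof. by move=> rw sw; exists (Sub (Bseq sw) rw); rewrite /word !SubK. Qed.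

Lemma word_size x : (size (word x) <= r)%N.
Proof. exact: size_bseq. Qed.

Lemma word_reduced x : reduced (word x).
Proof. exact: (valP x). Qed.

Lemma adj_letter_mul x y : adj x y = [exists a, word y == letter_mul a (word x)].
Proof.
apply/existsP/existsP => -[a].
  have := word_reduced y; rewrite -/(word x) -/(word y).
  move=> ry /orP[/eqP yx|/eqP xy]; exists a; last by rewrite xy /= eqxx.
  move: ry; rewrite yx; case: (word x) => //= b w /andP[/negbTE-> _] //.
case xE: (word x) => [|b w] /= => [/eqP yE|].
  by exists a; rewrite -/(word x) -/(word y) xE yE eqxx.
case: (a =P b) => _ /eqP yE; last by exists a; rewrite -/(word x) -/(word y) xE yE eqxx.
by exists b; rewrite -/(word x) -/(word y) xE yE eqxx orbT.
Qed.

(** Below the boundary all [d] products by a letter stay in the ball, and they are distinct. *)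
Lemma inner_degree x : (size (word x) < r)%N -> #|[set y | adj x y]| = d.
Proof.
move=> xr.
have ex a : exists y, word y == letter_mul a (word x).
  have [||y yE] := @exists_word (letter_mul a (word x)).
  - exact/letter_mul_reduced/word_reduced.
  - exact: leq_trans (letter_mul_size _ _) xr.
  - by exists y; rewrite yE.
pose f a := xchoose (ex a).
have fE a : word (f a) = letter_mul a (word x) by apply/eqP; exact: (xchooseP (ex a)).
have -> : [set y | adj x y] = f @: [set: 'I_d].
  apply/setP => y; rewrite inE adj_letter_mul; apply/existsP/imsetP.
    by case=> a /eqP ya; exists a => //; apply: word_inj; rewrite fE.
  by case=> a _ ->; exists a; rewrite fE.
rewrite card_imset ?cardsT ?card_ord // => a a' /(congr1 word).
by rewrite !fE => /letter_mul_inj.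
Qed.

(** Adding a letter would leave the ball, so only deleting the first letter remains; for [r = 0]
    there is no neighbour at all. *)
Lemma leaf_degree x : size (word x) = r -> (#|[set y | adj x y]| <= 1)%N.
Proof.
move=> xr; apply/card_le1_eqP => y z; rewrite !inE => /existsP[a] + /existsP[a'].
rewrite -!/(word _); have := word_size y; have := word_size z.
move=> zr yr /orP[/eqP yE|/eqP xy]; first by move: yr; rewrite yE /= xr ltnn.
move=> /orP[/eqP zE|/eqP xz]; first by move: zr; rewrite zE /= xr ltnn.
by apply: word_inj; move: xz; rewrite xy => -[].
Qed.

Lemma ball_degree x : #|[set y | adj x y]| = d \/ (#|[set y | adj x y]| <= 1)%N.
Proof.
have := word_size x; rewrite leq_eqVlt.
by case/orP => [/eqP/leaf_degree|/inner_degree]; [right|left].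
Qed.

End BallDegree.

(** * Joining two copies of a rooted tree under a new root *)

(** Bare data without laws; the facts about degrees and depth are proved by induction for
    [binary_tree]. *)
Record rooted_tree := RootedTree {
  shape :> sgraph;
  root : shape;
  leaves : {set shape};
  depth : shape -> nat
}.

Lemma point_sym : symmetric (fun _ _ : unit => false). Proof. by []. Qed.
Lemma point_irr : irreflexive (fun _ _ : unit => false). Proof. by []. Qed.

Definition point_tree : rooted_tree :=
  @RootedTree (SGraph point_sym point_irr) tt [set: unit] (fun=> 0%N).

Section Join.
Variable T : rooted_tree.

Definition join_vertex : finType := (unit + (T + T))%type.

Definition join_adj : rel join_vertex := fun x y =>
  match x, y with
  | inl _, inr (inl z) | inl _, inr (inr z)
  | inr (inl z), inl _ | inr (inr z), inl _ => z == root T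
  | inr (inl a), inr (inl b) | inr (inr a), inr (inr b) => adj a b
  | _, _ => false
  end.

Lemma join_adj_sym : symmetric join_adj.
Proof. by move=> [a|[a|a]] [b|[b|b]] //=; exact: adj_sym. Qed.

Lemma join_adj_irr : irreflexive join_adj.
Proof. by move=> [a|[a|a]] //=; exact: adj_irr. Qed.

Definition join_tree : rooted_tree :=
  @RootedTree (SGraph join_adj_sym join_adj_irr) (inl tt)
    [set x : join_vertex | match x with
      | inl _ => false | inr (inl y) | inr (inr y) => y \in leaves T end]
    (fun x : join_vertex => match x with
      | inl _ => 0 | inr (inl y) | inr (inr y) => (depth y).+1 end)%N.

Definition paste (i : bool) (t1 t2 : config T) : config join_tree :=
  [ffun x : join_vertex => match x with
    | inl _ => i | inr (inl y) => t1 y | inr (inr y) => t2 y end].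

Lemma big_unit (R : Type) (idx : R) (op : Monoid.law idx) (F : unit -> R) :
  \big[op/idx]_(x : unit) F x = F tt.
Proof. by rewrite (big_pred1 tt) // => -[]. Qed.

Variables (R : realType) (beta gamma lambda : R).
Local Notation A := (interaction beta gamma).
Local Notation w := (weight beta gamma lambda).

(** The edges are those inside each copy and the two joining the new root to the old ones; orienting
    the latter out of the new root makes the product split. *)
Lemma weight_paste i t1 t2 :
  w (paste i t1 t2) =
  local_field lambda i * (A i (t1 (root T)) * w t1) * (A i (t2 (root T)) * w t2).
Proof.
pose o : rel join_tree := fun x y : join_vertex =>
  match x, y with
  | inl _, _ => true
  | inr (inl a), inr (inl b) | inr (inr a), inr (inr b) => (enum_rank a < enum_rank b)%N
  | _, _ => false
  end.
have Ho x y : adj x y -> o y x = ~~ o x y.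
  by case: x y => [a|[a|a]] [b|[b|b]] //=; exact: enum_rank_orientation.
rewrite (weight_orientation _ _ _ _ Ho).
rewrite -(pair_big_dep xpredT (fun x y => adj x y && o x y)
   (fun x y => A (paste i t1 t2 x) (paste i t1 t2 y))) /=.
rewrite big_sumType [\prod_(u : join_vertex) _]big_sumType /= !big_unit.
rewrite !big_sumType /= [X in X * _ * _ * _]big_pred0 //.
rewrite !ffunE mul1r.
have one (F : T -> R) : \prod_(y | (y == root T) && true) F y = F (root T).
  by rewrite (big_pred1 (root T)) // => y; rewrite andbT.
rewrite !one !ffunE.
pose ledge (a b : T) := adj a b && (enum_rank a < enum_rank b)%N.
pose edges (t : config T) := \prod_(e : T * T | ledge e.1 e.2) A (t e.1) (t e.2).
have edgesE t : edges t = \prod_a \prod_(b | ledge a b) A (t a) (t b).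
  by rewrite pair_big_dep.
have fields t : w t = edges t * \prod_v local_field lambda (t v) by [].
rewrite (eq_bigr (fun a => \prod_(b | ledge a b) A (t1 a) (t1 b))); last first.
  move=> a _; rewrite big_sumType /= big_pred0 ?mul1r; last first.
    by move=> y; rewrite andbF.
  rewrite big_sumType /= [X in _ * X]big_pred0 // mulr1.
  by apply: eq_bigr => b _; rewrite !ffunE.
rewrite [X in _ * (_ * X) * _](eq_bigr (fun a =>
  \prod_(b | ledge a b) A (t2 a) (t2 b))); last first.
  move=> a _; rewrite big_sumType /= big_pred0 ?mul1r; last first.
    by move=> y; rewrite andbF.
  rewrite big_sumType /= big_pred0 // mul1r.
  by apply: eq_bigr => b _; rewrite !ffunE.
rewrite -!edgesE.
rewrite (eq_bigr (fun v => local_field lambda (t1 v))) => [|v _]; last first.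
  by rewrite ffunE.
rewrite [X in _ * (_ * (_ * X))](eq_bigr (fun v => local_field lambda (t2 v)))
  => [|v _]; last by rewrite ffunE.
by rewrite !fields; ring.
Qed.

End Join.

(** * Partition functions with constant spin on the leaves *)

Section BoundaryWeights.
Variables (R : realType) (beta gamma lambda : R).
Local Notation A := (interaction beta gamma).
Local Notation w := (weight beta gamma lambda).

Definition constant_config (T : rooted_tree) (j : bool) : config T := [ffun=> j].

Definition leaf_spin (T : rooted_tree) (j : bool) : pred (config T) :=
  agree (leaves T) (constant_config T j).
Arguments leaf_spin : clear implicits.

Definition root_weight (T : rooted_tree) (j i : bool) : R :=
  \sum_(t | leaf_spin T j t && (t (root T) == i)) w t.

Lemma root_weight_point j i :
  root_weight point_tree j i = if i == j then local_field lambda i else 0.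
Proof.
have aE (t : config point_tree) :
    leaf_spin point_tree j t = (t tt == j).
  apply/forall_inP/eqP => [/(_ tt)|tj []]; rewrite !ffunE ?tj // => H.
  exact/eqP/H/in_setT.
rewrite /root_weight; case: eqP => [->|/eqP ij]; last first.
  apply: big_pred0 => t; rewrite aE /=; apply: contraNF ij => /andP[/eqP <-].
  by rewrite eq_sym.
rewrite (big_pred1 [ffun=> j]) => [|t]; last first.
  rewrite aE andbb /=; apply/eqP/eqP => [tj|->]; last by rewrite ffunE.
  by apply/ffunP => -[]; rewrite ffunE.
rewrite /weight [X in X * _]big_pred0 => [|[[] []]] //.
by rewrite mul1r (@big_unit R 1 *%R) ffunE.
Qed.

Lemma leaf_spin_paste (T : rooted_tree) j i (t1 t2 : config T) :
  leaf_spin (join_tree T) j (paste i t1 t2) =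
  leaf_spin T j t1 && leaf_spin T j t2.
Proof.
apply/forall_inP/andP => [H|[/forall_inP H1 /forall_inP H2] [y|[y|y]]].
- split; apply/forall_inP => u uL.
  + by have := H (inr (inl u)); rewrite !inE !ffunE; apply.
  + by have := H (inr (inr u)); rewrite !inE !ffunE; apply.
- by rewrite inE.
- by rewrite inE => /H1; rewrite !ffunE.
- by rewrite inE => /H2; rewrite !ffunE.
Qed.

(** The tree recursion: given the root spin, the two copies are independent and identical, so the
    sum over pairs is a square. *)
Lemma root_weight_join (T : rooted_tree) j i :
  root_weight (join_tree T) j i =
  local_field lambda i *
  (A i false * root_weight T j false + A i true * root_weight T j true) ^+ 2.
Proof.
have -> : A i false * root_weight T j false + A i true * root_weight T j true =
    \sum_(t | leaf_spin T j t) A i (t (root T)) * w t.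
  rewrite (bigID (fun t : config T => t (root T) == false)) /= /root_weight !mulr_sumr.
  congr (_ + _); last rewrite [RHS]
    (eq_bigl (fun t => leaf_spin T j t && (t (root T) == true))).
  - by apply: eq_bigr => t /andP[_ /eqP ->].
  - by apply: eq_bigr => t /andP[_ /eqP ->].
  - by move=> t; case: (t (root T)).
rewrite /root_weight (reindex_onto (fun p : config T * config T => paste i p.1 p.2)
  (fun t => ([ffun y => t (inr (inl y))], [ffun y => t (inr (inr y))]))) /=; last first.
  move=> t /andP[_ /eqP ti]; apply/ffunP => -[[]|[y|y]]; rewrite !ffunE //.
rewrite (eq_bigl (fun p => leaf_spin T j p.1 && leaf_spin T j p.2)); last first.
  move=> [t1 t2] /=; rewrite leaf_spin_paste ffunE eqxx andbT.
  case: eqP => [_|[]]; rewrite ?andbT //.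
  by congr (_, _); apply/ffunP => y; rewrite !ffunE.
rewrite -(pair_big _ _ (fun t1 t2 => w (paste i t1 t2))) /= expr2 mulrA.
rewrite [X in X * _]mulr_sumr mulr_suml.
apply: eq_bigr => t1 _; rewrite mulr_sumr; apply: eq_bigr => t2 _.
by rewrite weight_paste.
Qed.

Lemma mass_root_weight (T : rooted_tree) j :
  mass beta gamma lambda (leaves T) (constant_config T j) (fun=> 1) =
  root_weight T j false + root_weight T j true.
Proof.
rewrite /mass (bigID (fun t : config T => t (root T) == false)) /=.
congr (_ + _); last rewrite [LHS]
    (eq_bigl (fun t => leaf_spin T j t && (t (root T) == true))).
- by apply: eq_bigr => t _; rewrite mulr1.
- by apply: eq_bigr => t _; rewrite mulr1.
- by move=> t; case: (t (root T)).
Qed.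

Lemma prob_leaves_gt0 (T : rooted_tree) j :
  0 <= beta -> 0 < gamma -> 0 < lambda ->
  0 < root_weight T j false + root_weight T j true ->
  0 < prob beta gamma lambda (leaf_spin T j).
Proof.
move=> b0 g0 l0; rewrite -mass_root_weight /mass => H.
have {}H : 0 < \sum_(t | leaf_spin T j t) w t.
  by move: H; under eq_bigr do rewrite mulr1.
rewrite /prob /gibbs -mulr_suml divr_gt0 //; apply: lt_le_trans H _.
rewrite [leRHS](bigID (leaf_spin T j)) /= lerDl.
by apply: sumr_ge0 => t _; exact: weight_ge0.
Qed.

Lemma marginal0_root (T : rooted_tree) j :
  0 <= beta -> 0 < gamma -> 0 < lambda ->
  0 < root_weight T j false + root_weight T j true ->
  marginal0 beta gamma lambda (root T) (leaves T) (constant_config T j) =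
  root_weight T j false / (root_weight T j false + root_weight T j true).
Proof.
move=> b0 g0 l0 H; rewrite marginal0E //; last exact: prob_leaves_gt0.
rewrite /cond_exp mass_root_weight; congr (_ / _).
rewrite /mass /root_weight [RHS]big_mkcondr; apply: eq_bigr => t _.
by case: eqP => _; rewrite ?mulr1 ?mulr0.
Qed.

End BoundaryWeights.

(** * Degrees and distances in binary trees *)

Fixpoint binary_tree (n : nat) : rooted_tree :=
  if n is m.+1 then join_tree (binary_tree m) else point_tree.

(** The sharper bound at the root carries the induction: the root gains one neighbour at the next
    join. *)
Lemma binary_tree_degree n :
  (#|[set u | adj (root (binary_tree n)) u]| <= 2)%N /\
  max_degree_le 3 (binary_tree n).
Proof.
elim: n => [|n [IHr IH]]; first by split=> [|u]; rewrite -sum1dep_card big_pred0.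
have degE (x : join_tree (binary_tree n)) : #|[set u | adj x u]| =
    match (x : join_vertex (binary_tree n)) with
    | inl _ => 2
    | inr (inl y) | inr (inr y) => (y == root (binary_tree n)) + #|[set u | adj y u]|
    end%N.
  rewrite -sum1dep_card big_sumType /= big_mkcond /= (@big_unit _ 0%N addn).
  rewrite big_sumType /=; case: x => [a|[a|a]] /=.
  - by rewrite !big_pred1_eq.
  - by rewrite [X in (_ + (_ + X))%N]big_pred0 // sum1dep_card addn0; case: eqP.
  - by rewrite [X in (_ + (X + _))%N]big_pred0 // sum1dep_card add0n; case: eqP.
split=> [|x]; rewrite degE //.
have H y : ((y == root (binary_tree n)) + #|[set u | adj y u]| <= 3)%N.
  by case: eqP => [->|_]; [rewrite add1n ltnS|exact: IH].
by case: x => [a|[a|a]] //=.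
Qed.

Lemma binary_tree_depth n :
  [/\ depth (root (binary_tree n)) = 0%N,
      forall x, x \in leaves (binary_tree n) -> depth x = n &
      forall x y : binary_tree n, adj x y -> (depth y <= (depth x).+1)%N].
Proof.
elim: n => [|n [IHr IHl IHa]]; first by split.
split=> //=.
- by move=> [a|[a|a]]; rewrite inE // => /IHl ->.
- by move=> [a|[a|a]] [b|[b|b]] //=; do ?[by move/eqP->; rewrite IHr]; move/IHa.
Qed.

Lemma path_depth (G : sgraph) (h : G -> nat) :
  (forall x y, adj x y -> (h y <= (h x).+1)%N) ->
  forall p x, path (@adj G) x p -> (h (last x p) <= h x + size p)%N.
Proof.
move=> Ha; elim=> [|y p IH] x /=; first by rewrite addn0.
move=> /andP[/Ha xy /IH H]; apply: leq_trans H _.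
by rewrite addnS -addSn leq_add2r.
Qed.

(** Depth grows by at most one along an edge, starts at 0 at the root and equals [n] on the
    leaves. *)
Lemma dist_leaves n (S : {set binary_tree n}) :
  S \subset leaves (binary_tree n) ->
  forall k, dist (root (binary_tree n)) S = Some k -> (n <= k)%N.
Proof.
move=> /subsetP SL k; rewrite /dist => E.
have [Hr Hl Ha] := binary_tree_depth n.
have : k \in [seq m <- iota 0 #|binary_tree n| |
    [exists p : m.-tuple (binary_tree n), path (@adj _) (root (binary_tree n)) p
      && (last (root (binary_tree n)) p \in S)]].
  by move: E; case: [seq _ <- _ | _] => //= a l [->]; rewrite inE eqxx.
rewrite mem_filter => /andP[/existsP[p /andP[pp /SL/Hl lp]] _].
by have := path_depth Ha pp; rewrite lp Hr add0n size_tuple.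
Qed.

(** * Two alternating phases on binary trees *)

Section PhaseCoexistence.
Variables (R : realType) (gamma : R).
Hypothesis gamma0 : 0 < gamma.
Local Notation lambda := (16 * gamma ^+ 3).
Local Notation Z := (root_weight 0 gamma lambda).

(** Bounds on the ratio [z0 / z1] written without division, since a single vertex with fixed spin
    has ratio 0 or infinity. *)
Definition low_phase (z0 z1 : R) := [/\ 0 <= z0, 0 < z1 & z0 <= gamma * z1].
Definition high_phase (z0 z1 : R) := [/\ 0 < z0, 0 <= z1 & 4 * gamma * z1 <= z0].

Lemma low_to_high z0 z1 : low_phase z0 z1 ->
  high_phase (lambda * z1 ^+ 2) ((z0 + gamma * z1) ^+ 2).
Proof.
case=> z00 z10 zz; have g3 : 0 < gamma ^+ 3 by exact: exprn_gt0.
split; [by rewrite !mulr_gt0 // exprn_gt0|exact: sqr_ge0|].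
(* In the low phase [z0 + gamma * z1] is at most [2 * (gamma * z1)]; the value of [lambda] is
   [4 * gamma] times the square of [2 * gamma]. *)
have -> : lambda * z1 ^+ 2 = 4 * gamma * (2 * (gamma * z1)) ^+ 2 by ring.
rewrite ler_pM2l ?mulr_gt0 // lerXn2r // ?nnegrE; nra.
Qed.

Lemma high_to_low z0 z1 : high_phase z0 z1 ->
  low_phase (lambda * z1 ^+ 2) ((z0 + gamma * z1) ^+ 2).
Proof.
case=> z00 z10 zz; have g3 : 0 < gamma ^+ 3 by exact: exprn_gt0.
have gz : 0 <= gamma * z1 by rewrite mulr_ge0 // ltW.
split; [by rewrite !mulr_ge0 ?sqr_ge0 // ltW|by rewrite exprn_gt0 // ltr_wpDr|].
(* In the high phase [z0 + gamma * z1] is at least [4 * (gamma * z1)], and [lambda] is also [gamma]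
   times the square of [4 * gamma]. *)
have -> : lambda * z1 ^+ 2 = gamma * (4 * (gamma * z1)) ^+ 2 by ring.
rewrite ler_pM2l // lerXn2r // ?nnegrE; nra.
Qed.

(** The leaf spin [j] that leads to the high phase alternates with the parity of [n], hence the
    existential. *)
Lemma binary_tree_phases n :
  exists j, high_phase (Z (binary_tree n) j false) (Z (binary_tree n) j true) /\
            low_phase (Z (binary_tree n) (~~ j) false) (Z (binary_tree n) (~~ j) true).
Proof.
have l0 : 0 < lambda by rewrite mulr_gt0 // exprn_gt0.
elim: n => [|n [j [Hh Hl]]].
  exists false; rewrite !root_weight_point /=.
  by split; split=> //; rewrite ?mulr0 ?mulr1 ltW.
exists (~~ j); rewrite negbK !root_weight_join /= !mul0r !add0r !mul1r.
by split; [exact: low_to_high|exact: high_to_low].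
Qed.

End PhaseCoexistence.

(** * Mixing on the tree, failure of mixing on bounded-degree graphs *)

Lemma tree_ball_mixing (R : realType) (gamma : R) : 64 <= gamma ->
  strong_spatial_mixing 0 gamma (16 * gamma ^+ 3) (regular_tree_balls 4).
Proof.
move=> g64; have g0 : 0 < gamma by apply: lt_le_trans g64.
have l0 : 0 < 16 * gamma ^+ 3 by rewrite mulr_gt0 // exprn_gt0.
have q0 : 0 < 16 * gamma ^+ 2 + 1 by rewrite addr_gt0 // mulr_gt0 // exprn_gt0.
(* The rate [c] is chosen so that the influence on a vertex of degree 1 is exactly [1 - c], which is
   at most [expR (- c)]. *)
apply: (@dobrushin_ssm _ _ _ _ _ _ _ _ ((16 * gamma ^+ 2 + 1)^-1)) => //.
  by rewrite invr_gt0.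
move=> G [r ->].
exists (fun v => 16 * gamma ^+ 3 / (16 * gamma ^+ 3 + gamma ^+ #|[set u | adj v u]|)).
split=> v; first by move=> x; exact: heat_prob_hardcore.
apply: le_trans (expR_ge1Dx _).
have leaf : 16 * gamma ^+ 3 / (16 * gamma ^+ 3 + gamma) = 1 - (16 * gamma ^+ 2 + 1)^-1.
  by field; rewrite !lt0r_neq0 // addr_gt0.
have inner : 16 * gamma ^+ 3 / (16 * gamma ^+ 3 + gamma ^+ 4) * 4 = 64 / (16 + gamma).
  by field; rewrite !lt0r_neq0 // addr_gt0 // exprn_gt0.
(* Hence [1 - c] is at least 4/5, while the inner influence [64 / (16 + gamma)] is at most 4/5
   exactly when [gamma >= 64]. *)
have le15 : (16 * gamma ^+ 2 + 1)^-1 <= 5^-1 by rewrite lef_pV2 ?posrE //; nra.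
suff bound k : k = 4%N \/ (k <= 1)%N ->
    16 * gamma ^+ 3 / (16 * gamma ^+ 3 + gamma ^+ k) * k%:R
      <= 1 - (16 * gamma ^+ 2 + 1)^-1 by exact: bound (ball_degree v).
case=> [->|].
  rewrite inner; apply: le_trans (_ : 4 / 5 <= _); last lra.
  rewrite ler_pdivrMr ?addr_gt0 //; lra.
case: k => [_|[_|//]]; first by rewrite mulr0; lra.
by rewrite mulr1 expr1 leaf.
Qed.

Lemma bounded_degree_not_mixing (R : realType) (gamma : R) (d : nat) :
  0 < gamma -> (3 <= d)%N ->
  ~ strong_spatial_mixing 0 gamma (16 * gamma ^+ 3) (max_degree_le d).
Proof.
move=> g0 d3 [C [c [C0 c0 mix]]].
have l0 : 0 < 16 * gamma ^+ 3 by rewrite mulr_gt0 // exprn_gt0.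
(* The root has spin 0 with probability at least [4 * gamma / (4 * gamma + 1)] in the high phase and
   at most [gamma / (gamma + 1)] in the low one; mixing would bound this gap by [C * expR (- c * n)]
   for every [n]. *)
pose gap : R := 4 * gamma / (4 * gamma + 1) - gamma / (gamma + 1).
have gap0 : 0 < gap.
  rewrite subr_gt0 ltr_pdivrMr ?addr_gt0 // mulrAC.
  rewrite ltr_pdivlMr ?addr_gt0 ?mulr_gt0 //; nra.
suff : gap <= 0 by rewrite leNgt gap0.
apply: (expR_decay_le0 C0 c0) => n.
have [j [[h0 h1 hh] [k0 k1 kk]]] := binary_tree_phases g0 n.
have hZ : 0 < root_weight 0 gamma (16 * gamma ^+ 3) (binary_tree n) j false
  + root_weight 0 gamma (16 * gamma ^+ 3) (binary_tree n) j true by lra.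
have kZ : 0 < root_weight 0 gamma (16 * gamma ^+ 3) (binary_tree n) (~~ j) false
  + root_weight 0 gamma (16 * gamma ^+ 3) (binary_tree n) (~~ j) true by lra.
have deg : max_degree_le d (binary_tree n).
  by move=> u; apply: leq_trans d3; exact: (binary_tree_degree n).2.
have := mix _ deg (root (binary_tree n)) _ _ _
  (prob_leaves_gt0 (lexx 0) g0 l0 hZ) (prob_leaves_gt0 (lexx 0) g0 l0 kZ).
rewrite !marginal0_root // => H.
apply: le_trans (le_trans H _); last first.
  (* The discrepancy lies in the leaves, so its distance from the root is at least [n], or infinite
     with decay 0. *)
  rewrite ler_pM2l // /decay; case E: (dist _ _) => [k|]; last exact: expR_ge0.
  rewrite ler_expR !mulNr lerN2 ler_pM2l // ler_nat.
  by apply: dist_leaves E; apply/subsetP => u; rewrite inE => /andP[].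
apply: le_trans (ler_norm _); apply: lerB.
  rewrite ler_pdivlMr // mulrAC ler_pdivrMr ?addr_gt0 ?mulr_gt0 //; nra.
rewrite ler_pdivrMr // mulrAC ler_pdivlMr ?addr_gt0 //; nra.
Qed.

Theorem theorem8 (R : realType) :
  exists (beta gamma lambda : R) (d : nat),
    [/\ antiferromagnetic beta gamma lambda,
        (2 <= d)%N,
        strong_spatial_mixing beta gamma lambda (regular_tree_balls d) &
        ~ strong_spatial_mixing beta gamma lambda (max_degree_le d)].
Proof.
exists 0, 64, (16 * 64 ^+ 3), 4%N; split=> //.
- by split; rewrite ?mul0r // mulr_gt0 // exprn_gt0.
- exact: tree_ball_mixing.
- exact: bounded_degree_not_mixing.
Qed.
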